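(* Let $\mathcal A$ be a $^*$-algebra over $\mathsf C$ and $\omega:\mathcal A\to\mathsf C$ a positive linear functional. Regard $\mathcal A$ as an $(\mathcal A$-$\mathsf C)$-bimodule via left multiplication and scalar multiplication, with $\mathsf C$-valued inner product $\langle A,B\rangle_\omega=\omega(A^*B)$. Then the GNS representation $\pi_\omega$ coincides (under the canonical identification $\mathcal A\otimes_{\mathsf C}\mathsf C\cong\mathcal A$) with the $^*$-representation of $\mathcal A$ obtained by algebraic Rieffel induction, by means of this bimodule, from the canonical $^*$-representation of $\mathsf C$ on itself: the map $[A\otimes z]\mapsto\psi_{zA}$ is a unitary intertwiner from the induced representation onto $(\mathfrak H_\omega,\pi_\omega)$.
   Context: $\mathsf R$ is an ordered ring (commutative ring with $1\ne0$ and a subset $\mathsf P$ closed under sums and products such that $\mathsf R$ is the disjoint union $-\mathsf P\cup\{0\}\cup\mathsf P$), and $\mathsf C=\mathsf R(\mathrm i)=\mathsf R\oplus\mathrm i\mathsf R$, $\mathrm i^2=-1$, with the usual conjugation. A $^*$-algebra over $\mathsf C$ is an associative (not necessarily unital) $\mathsf C$-algebra with an antilinear involution satisfying $(AB)^*=B^*A^*$. $\omega$ linear is positive if $\omega(A^*A)\ge0$ for all $A$. A pre-Hilbert space over $\mathsf C$ is a $\mathsf C$-module with a Hermitian inner product (linear in the second argument), $\langle\phi,\phi\rangle\ge0$, and $\langle\phi,\phi\rangle=0\Rightarrow\phi=0$. A $^*$-representation is a $^*$-homomorphism into the $^*$-algebra of adjointable endomorphisms of a pre-Hilbert space. GNS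 representation: $\mathcal J_\omega=\{A\in\mathcal A\mid\omega(A^*A)=0\}$ is a left ideal, $\mathfrak H_\omega=\mathcal A/\mathcal J_\omega$ has inner product $\langle\psi_A,\psi_B\rangle=\omega(A^*B)$ where $\psi_A$ is the class of $A$, and $\pi_\omega(A)\psi_B=\psi_{AB}$. The canonical representation of $\mathsf C$ on itself is by multiplication, with $\langle z,w\rangle=\bar zw$. Algebraic Rieffel induction: given a $(\mathcal B$-$\mathcal D)$-bimodule $\mathfrak X$ with a suitable $\mathcal D$-valued inner product $\langle\cdot,\cdot\rangle_{\mathcal D}$ and a $^*$-representation $(\mathfrak H,\pi)$ of $\mathcal D$, put on $\widetilde{\mathfrak K}=\mathfrak X\otimes_{\mathcal D}\mathfrak H$ the form $\langle x\otimes\psi,y\otimes\phi\rangle=\langle\psi,\pi(\langle x,y\rangle_{\mathcal D})\phi\rangle_{\mathfrak H}$; when it is positive semi-definite, the induced $^*$-representation of $\mathcal B$ acts on $\mathfrak K=\widetilde{\mathfrak K}/\widetilde{\mathfrak K}^\perp$ by $B[x\otimes\psi]=[B\cdot x\otimes\psi]$. Here it is applied with $\mathcal B=\mathcal A$, $\mathcal D=\mathsf C$, $\mathfrak X=\mathcal A$. *)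

(* Defs.v *)
From HB Require Import structures.
From mathcomp Require Import all_boot all_order all_algebra.
From mathcomp Require Import boolp.
From mathcomp Require Import ring_quotient generic_quotient.
From mathcomp Require Import complex.
From mathcomp Require Import freeg.
From mathcomp Require Import ring lra.

Set Implicit Arguments.
Unset Strict Implicit.
Unset Printing Implicit Defensive.

Import Order.TTheory GRing.Theory Num.Theory.
Local Open Scope ring_scope.
Local Open Scope quotient_scope.
Local Open Scope complex_scope.

Local Notation Re := complex.Re.
Local Notation Im := complex.Im.

(* A commutative ring with a positive cone satisfying trichotomy is an
   integral domain, so ordered rings are [realDomainType]s; the norm, units
   and choice operator of that structure exist classically for every such ring.

   The library puts a ring structure on [R[i]] only when [R] is a field.
   The alias [cplx R] carries the same operations over any ordered ring. *)
Definition cplx (R : realDomainType) := R[i].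

HB.instance Definition _ (R : realDomainType) := Choice.on (cplx R).
HB.instance Definition _ (R : realDomainType) := GRing.Zmodule.copy (cplx R) R[i].

Section CplxRing.
Variable R : realDomainType.
Implicit Types x y z : cplx R.

Fact cplx_mul1 : left_id ((1 : R)%:C : cplx R) (@ComplexField.mulc R).
Proof. by move=> [a b] /=; rewrite !mul1r !mul0r subr0 addr0. Qed.

Fact cplx_mulDl :
  left_distributive (@ComplexField.mulc R : cplx R -> cplx R -> cplx R) +%R.
Proof.
move=> [a b] [c d] [e f] /=; apply/eqP; rewrite eq_complex /=.
by apply/andP; split; apply/eqP; ring.
Qed.

Fact cplx_nonzero1 : ((1 : R)%:C : cplx R) != 0.
Proof. by rewrite eq_complex /= oner_eq0. Qed.

HB.instance Definition _ := GRing.Zmodule_isComNzRing.Build (cplx R)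
  (@ComplexField.mulcA R) (@ComplexField.mulcC R)
  cplx_mul1 cplx_mulDl cplx_nonzero1.

Definition cconj (z : cplx R) : cplx R := conjc z.

Fact cconj_zmod : zmod_morphism cconj.
Proof. by move=> [a b] [c d]; apply/eqP; rewrite eq_complex /= opprD eqxx /= opprK. Qed.
Fact cconj_monoid : monoid_morphism cconj.
Proof.
split; first by apply/eqP; rewrite eq_complex /= oppr0 !eqxx.
by move=> [a b] [c d]; apply/eqP; rewrite eq_complex /=;
   apply/andP; split; apply/eqP; ring.
Qed.
HB.instance Definition _ :=
  GRing.isZmodMorphism.Build (cplx R) (cplx R) cconj cconj_zmod.
HB.instance Definition _ :=
  GRing.isMonoidMorphism.Build (cplx R) (cplx R) cconj cconj_monoid.

Lemma cconjK : involutive cconj.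
Proof. by move=> [a b]; rewrite /cconj /= opprK. Qed.

(* [z >= 0] in [R(i)] means that [z] lies in the subring [R] and is [>= 0]. *)
Definition cge0 (z : cplx R) : Prop := Im z = 0 /\ 0 <= Re z.

Lemma ReD x y : Re (x + y) = Re x + Re y. Proof. by case: x y => ? ? []. Qed.
Lemma ImD x y : Im (x + y) = Im x + Im y. Proof. by case: x y => ? ? []. Qed.
Lemma ReM x y : Re (x * y) = Re x * Re y - Im x * Im y.
Proof. by case: x y => ? ? []. Qed.
Lemma ImM x y : Im (x * y) = Re x * Im y + Im x * Re y.
Proof. by case: x y => ? ? []. Qed.
Lemma ReJ x : Re (cconj x) = Re x. Proof. by case: x. Qed.
Lemma ImJ x : Im (cconj x) = - Im x. Proof. by case: x. Qed.

Lemma cplxP x y : Re x = Re y -> Im x = Im y -> x = y.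
Proof. by case: x y => a b [c d] /= -> ->. Qed.

Lemma cge0M x y : cge0 x -> cge0 y -> cge0 (x * y).
Proof.
move=> [x0 xp] [y0 yp]; split; first by rewrite ImM x0 y0 mulr0 mul0r addr0.
by rewrite ReM x0 mul0r subr0 mulr_ge0.
Qed.

Lemma cge0_conjM x : cge0 (cconj x * x).
Proof.
split; first by rewrite ImM ReJ ImJ; ring.
by rewrite ReM ReJ ImJ mulNr opprK addr_ge0 // -expr2 sqr_ge0.
Qed.

End CplxRing.

Section PositiveForms.
Variables (R : realDomainType) (V : lmodType (cplx R)).
Variable h : V -> V -> cplx R.
Hypothesis h_lin : forall x, scalar (h x).

Lemma sform0r x : h x 0 = 0.
Proof. by have /(_ (-1) 0 0) := h_lin x; rewrite scaleN1r addNr mulN1r addNr. Qed.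
Lemma sformDr x y z : h x (y + z) = h x y + h x z.
Proof. by have := h_lin x 1 y z; rewrite scale1r mul1r. Qed.
Lemma sformZr a x y : h x (a *: y) = a * h x y.
Proof. by have := h_lin x a y 0; rewrite !addr0 sform0r addr0. Qed.
Lemma sformNr x y : h x (- y) = - h x y.
Proof. by rewrite -scaleN1r sformZr mulN1r. Qed.

Hypothesis h_herm : forall x y, h y x = cconj (h x y).

Lemma sformDl x y z : h (x + y) z = h x z + h y z.
Proof. by rewrite h_herm sformDr rmorphD /= -!h_herm. Qed.
Lemma sformZl a x y : h (a *: x) y = cconj a * h x y.
Proof. by rewrite h_herm sformZr rmorphM /= -h_herm. Qed.
Lemma sformNl x y : h (- x) y = - h x y.
Proof. by rewrite h_herm sformNr rmorphN /= -h_herm. Qed.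

Hypothesis h_ge0 : forall x, cge0 (h x x).

(* Division-free Cauchy-Schwarz in the degenerate case. *)
Lemma form_degenerate x : h x x = 0 -> forall y, h y x = 0.
Proof.
move=> hx0 y; set b := h y x; have hxy : h x y = cconj b by rewrite h_herm.
have [c0 cp] := h_ge0 y; set c := h y y in c0 cp.
set beta : cplx R := b * cconj b.
have [_] := h_ge0 (beta *: y + (- ((c + 1) * cconj b)) *: x).
rewrite !(sformDr, sformDl, sformZr, sformZl) hx0 hxy -/b -/c.
have rc : cconj c = c by apply: cplxP; [rewrite ReJ | rewrite ImJ c0 oppr0].
have rbeta : cconj beta = beta by rewrite /beta rmorphM /= cconjK mulrC.
rewrite rbeta rmorphN rmorphM /= cconjK rmorphD rmorph1 /= rc.
set e := (X in Re X); have {e} -> : e = - (beta * beta * (c + 2)).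
  by rewrite /e /beta; ring.
have Ib : Im beta = 0 by rewrite /beta ImM ReJ ImJ; ring.
have Rb : Re beta = Re b ^+ 2 + Im b ^+ 2 by rewrite /beta ReM ReJ ImJ; ring.
rewrite -mulrN ReM ReM ImM Ib !(mul0r, mulr0, subr0, addr0).
have -> : Re (- (c + 2)) = - (Re c + 2) by case: (c).
rewrite mulrN oppr_ge0 => le0.
have c2 : 0 < Re c + 2 by rewrite ltr_wpDl // ltr0n.
move: le0; rewrite pmulr_lle0 // -expr2 Rb => le0.
have /eqP : (Re b ^+ 2 + Im b ^+ 2) ^+ 2 = 0 by apply/le_anti; rewrite le0 sqr_ge0.
rewrite expf_eq0 /= paddr_eq0 ?sqr_ge0 // !expf_eq0 /= => /andP[/eqP ? /eqP ?].
exact: cplxP.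
Qed.
End PositiveForms.

Section QuotientModule.
Variables (K : nzRingType) (V : lmodType K) (S : {pred V}).
Hypothesis Ssub : submod_closed S.

Fact submod_zmod_closed : zmod_closed S.
Proof.
case: Ssub => S0 Slin; split=> // x y xS yS.
by rewrite addrC -scaleN1r Slin.
Qed.
Definition submod_zmod : zmodClosed V :=
  HB.pack (S : V -> bool) (GRing.isZmodClosed.Build V S submod_zmod_closed).

Definition lmod_quot := Quotient.quot submod_zmod.
HB.instance Definition _ := GRing.Zmodule.on lmod_quot.

Definition qclass (v : V) : lmod_quot := \pi_(Quotient.quot submod_zmod) v.
Definition qrepr (q : lmod_quot) : V := repr (q : Quotient.quot submod_zmod).

Lemma qreprK q : qclass (qrepr q) = q. Proof. exact: reprK. Qed.

Lemma qclass_eq v w : (qclass v == qclass w) = (v - w \in S).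
Proof. exact/esym/(Quotient.idealrBE submod_zmod). Qed.

Lemma qrepr_class v : qrepr (qclass v) - v \in S.
Proof. by rewrite -qclass_eq qreprK. Qed.

Fact qclass_zmod : zmod_morphism qclass.
Proof. by move=> v w; rewrite /qclass raddfB. Qed.
HB.instance Definition _ := GRing.isZmodMorphism.Build V lmod_quot qclass qclass_zmod.

Lemma subZ a v : v \in S -> a *: v \in S.
Proof. by case: Ssub => S0 Slin vS; rewrite -[_ *: _]addr0 Slin. Qed.

Definition qscale (a : K) (q : lmod_quot) : lmod_quot := qclass (a *: qrepr q).

Lemma qscaleE a v : qscale a (qclass v) = qclass (a *: v).
Proof. by apply/eqP; rewrite qclass_eq -scalerBr (subZ _ (qrepr_class v)). Qed.

Fact qscaleA a b q : qscale a (qscale b q) = qscale (a * b) q.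
Proof. by rewrite -[q]qreprK !qscaleE scalerA. Qed.
Fact qscale1 : left_id 1 qscale.
Proof. by move=> q; rewrite -[q]qreprK !qscaleE scale1r. Qed.
Fact qscaleDr : right_distributive qscale +%R.
Proof.
by move=> a q r; rewrite -[q]qreprK -[r]qreprK -raddfD !qscaleE scalerDr raddfD.
Qed.
Fact qscaleDl q : {morph qscale^~ q : a b / a + b}.
Proof. by move=> a b; rewrite -[q]qreprK !qscaleE scalerDl raddfD. Qed.
HB.instance Definition _ := GRing.Zmodule_isLmodule.Build K lmod_quot
  qscaleA qscale1 qscaleDr qscaleDl.

Fact qclass_scalable : scalable qclass.
Proof. by move=> a v; rewrite -qscaleE. Qed.
HB.instance Definition _ := GRing.isScalable.Build K V lmod_quot *:%R qclass qclass_scalable.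

End QuotientModule.

Section Structures.
Variable R : realDomainType.
Local Notation C := (cplx R).

Record starAlg := StarAlg {
  sa_sort :> lmodType C;
  smul : sa_sort -> sa_sort -> sa_sort;
  star : sa_sort -> sa_sort;
  smulA : associative smul;
  smul_linr : forall a, linear (smul a);
  smul_linl : forall b, linear (smul^~ b);
  star_antilin : forall z a b, star (z *: a + b) = cconj z *: star a + star b;
  starK : involutive star;
  starM : forall a b, star (smul a b) = smul (star b) (star a)
}.

Definition positive_functional (A : starAlg) (f : A -> C) : Prop :=
  forall a, cge0 (f (smul (star a) a)).

(* Algebraic positivity; [a] need not be a sum of elements [star b * b]. *)
Definition sa_ge0 (A : starAlg) (a : A) : Prop :=
  forall f : {scalar A}, positive_functional f -> cge0 (f a).

Record preHilbert := PreHilbert {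
  ph_sort :> lmodType C;
  ip : ph_sort -> ph_sort -> C;
  ip_lin : forall x, scalar (ip x);
  ip_herm : forall x y, ip y x = cconj (ip x y);
  ip_ge0 : forall x, cge0 (ip x x);
  ip_eq0 : forall x, ip x x = 0 -> x = 0
}.

(* [g] is an adjoint of [f]; it is unique as the inner product is
   nondegenerate. *)
Definition is_adjoint (H : preHilbert) (f g : H -> H) : Prop :=
  forall x y, ip x (f y) = ip (g x) y.

(* A *-homomorphism into the adjointable endomorphisms: [rep_adj] says both
   that each [rep a] is adjointable and that the adjoint is [rep (star a)]. *)
Record starRep (A : starAlg) := StarRep {
  rep_space :> preHilbert;
  rep : A -> rep_space -> rep_space;
  rep_linr : forall a, linear (rep a);
  rep_linl : forall x, linear (rep^~ x);
  repM : forall a b x, rep (smul a b) x = rep a (rep b x);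
  rep_adj : forall a, is_adjoint (rep a) (rep (star a))
}.

Definition unitary (H K : preHilbert) (U : H -> K) : Prop :=
  [/\ linear U, bijective U & forall x y, ip (U x) (U y) = ip x y].

Definition intertwiner (A : starAlg) (H K : starRep A) (U : H -> K) : Prop :=
  forall a x, U (rep a x) = rep a (U x).

(* [(B-D)]-bimodules with a positive semi-definite [D]-valued inner product
   compatible with the left action of [B]. *)
Record bimodule (B D : starAlg) := Bimodule {
  bm_sort :> lmodType C;
  lact : B -> bm_sort -> bm_sort;
  ract : bm_sort -> D -> bm_sort;
  inner : bm_sort -> bm_sort -> D;
  lact_linr : forall b, linear (lact b);
  lact_linl : forall x, linear (lact^~ x);
  ract_linr : forall x, linear (ract x);
  ract_linl : forall d, linear (ract^~ d);
  lactM : forall b c x, lact (smul b c) x = lact b (lact c x);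
  ractM : forall x d e, ract x (smul d e) = ract (ract x d) e;
  lractA : forall b x d, lact b (ract x d) = ract (lact b x) d;
  inner_lin : forall x, linear (inner x);
  inner_herm : forall x y, inner y x = star (inner x y);
  inner_ract : forall x y d, inner x (ract y d) = smul (inner x y) d;
  inner_lact : forall b x y, inner x (lact b y) = inner (lact (star b) x) y;
  inner_ge0 : forall x, sa_ge0 (inner x x)
}.

Lemma star_additive (A : starAlg) (a b : A) : star (a + b) = star a + star b.
Proof. by have := star_antilin 1 a b; rewrite !scale1r rmorph1 scale1r. Qed.
Lemma star0 (A : starAlg) : star 0 = 0 :> A.
Proof. by apply: (addrI (star 0)); rewrite -star_additive !addr0. Qed.
Lemma starZ (A : starAlg) z (a : A) : star (z *: a) = cconj z *: star a.
Proof. by have := star_antilin z a 0; rewrite !addr0 star0 addr0. Qed.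

Section Linear.
Variables (V W : lmodType C) (f : V -> W) (fl : linear f).
Lemma lin0 : f 0 = 0.
Proof. by have := fl (-1) 0 0; rewrite !scaleN1r !addNr. Qed.
Lemma linD x y : f (x + y) = f x + f y.
Proof. by have := fl 1 x y; rewrite !scale1r. Qed.
Lemma linZ a x : f (a *: x) = a *: f x.
Proof. by have := fl a x 0; rewrite !addr0 lin0 addr0. Qed.
Lemma linN x : f (- x) = - f x.
Proof. by rewrite -scaleN1r linZ scaleN1r. Qed.
Lemma linB x y : f (x - y) = f x - f y.
Proof. by rewrite linD linN. Qed.
Lemma lin_sum I (r : seq I) (F : I -> V) : f (\sum_(i <- r) F i) = \sum_(i <- r) f (F i).
Proof.
by elim: r => [|i r IH]; rewrite ?big_nil ?lin0 // !big_cons linD IH.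
Qed.
End Linear.

End Structures.

(* A positive semi-definite Hermitian form on [V] induces an inner product on
   the quotient of [V] by its degeneracy space. *)
Section FormQuotient.
Variables (R : realDomainType) (V : lmodType (cplx R)).
Local Notation C := (cplx R).
Variable h : V -> V -> C.
Hypotheses (h_lin : forall x, scalar (h x))
           (h_herm : forall x y, h y x = cconj (h x y))
           (h_ge0 : forall x, cge0 (h x x)).
Variables (S : {pred V}) (Ssub : submod_closed S).
Hypothesis S_null : forall x, (x \in S) <-> (h x x = 0).

Definition qform (p q : lmod_quot Ssub) : C := h (qrepr p) (qrepr q).

Lemma qformE v w : qform (qclass Ssub v) (qclass Ssub w) = h v w.
Proof.
have deg x y : x \in S -> h y x = 0 by move=> /S_null/(form_degenerate h_lin h_herm h_ge0).
rewrite /qform -[qrepr (qclass Ssub w)](subrK w) (sformDr h_lin).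
rewrite (deg _ _ (qrepr_class Ssub w)) add0r h_herm.
rewrite -[qrepr (qclass Ssub v)](subrK v) (sformDr h_lin).
by rewrite (deg _ _ (qrepr_class Ssub v)) add0r -h_herm.
Qed.

Fact qform_lin p : scalar (qform p).
Proof.
move=> a q r; rewrite -[p]qreprK -[q]qreprK -[r]qreprK -linearP !qformE.
exact: h_lin.
Qed.
Fact qform_herm p q : qform q p = cconj (qform p q). Proof. exact: h_herm. Qed.
Fact qform_ge0 p : cge0 (qform p p). Proof. exact: h_ge0. Qed.
Fact qform_eq0 p : qform p p = 0 -> p = 0.
Proof.
move=> /S_null pS; rewrite -[p]qreprK -[RHS](linear0 (qclass Ssub)).
by apply/eqP; rewrite qclass_eq subr0.
Qed.

Definition quot_preHilbert : preHilbert R :=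
  PreHilbert qform_lin qform_herm qform_ge0 qform_eq0.

(* A [*]-action on [V] by adjointable maps descends to the quotient. *)
Variable A : starAlg R.
Variable act : A -> V -> V.
Hypotheses (act_linr : forall a, linear (act a))
           (act_linl : forall x, linear (act^~ x))
           (actM : forall a b x, act (smul a b) x = act a (act b x))
           (act_adj : forall a x y, h x (act a y) = h (act (star a) x) y).

Definition qact (a : A) (q : lmod_quot Ssub) : lmod_quot Ssub := qclass Ssub (act a (qrepr q)).

Lemma qactE a v : qact a (qclass Ssub v) = qclass Ssub (act a v).
Proof.
apply/eqP; rewrite qclass_eq -(linB (act_linr a)); apply/S_null.
have /S_null := qrepr_class Ssub v; set u := _ - v => u0.
rewrite h_herm -[RHS](rmorph0 (@cconj R)) act_adj; congr cconj.
by rewrite (form_degenerate h_lin h_herm h_ge0 u0).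
Qed.

Fact qact_linr a : linear (qact a).
Proof.
move=> z p q; rewrite -[p]qreprK -[q]qreprK -linearP !qactE.
by rewrite (act_linr a) linearP.
Qed.
Fact qact_linl q : linear (qact^~ q).
Proof.
move=> z a b; rewrite -[q]qreprK !qactE.
by rewrite (act_linl (qrepr q)) linearP.
Qed.
Fact qactM a b q : qact (smul a b) q = qact a (qact b q).
Proof. by rewrite -[q]qreprK !qactE actM. Qed.
Fact qact_adj a : is_adjoint (H := quot_preHilbert) (qact a) (qact (star a)).
Proof.
move=> p q; rewrite /= -[p]qreprK -[q]qreprK !qactE !qformE.
exact: act_adj.
Qed.

Definition quot_starRep : starRep A :=
  StarRep (rep_space := quot_preHilbert) qact_linr qact_linl qactM qact_adj.

End FormQuotient.

Section FreeModule.
Variables (K : comNzRingType) (T : choiceType) (W : lmodType K) (f : T -> W).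
Local Notation F := {freeg T / K}.

Lemma freegUZ k x : << k *g x >> = k *: (<< 1 *g x >> : F).
Proof. by apply/eqP/freeg_eqP=> y; rewrite coeffZ !coeffU mul1r. Qed.

Lemma fglift_is_linear : linear (fglift f : F -> W).
Proof.
pose fD : {additive F -> W} :=
  HB.pack (fglift f) (GRing.isZmodMorphism.Build F W (fglift f) (lift_is_additive f)).
move=> a u v; rewrite -[fglift f]/(fD : F -> W) raddfD; congr (_ + _).
have -> : a *: u = \sum_(x <- dom u) << a * coeff x u *g x >> by [].
rewrite [in RHS](esym (freeg_sumE u)) !raddf_sum.
by apply: eq_bigr => x _; rewrite /= !liftU scalerA.
Qed.

Lemma freeg_ind (P : F -> Prop) :
  P 0 -> (forall k x u, P u -> P (k *: << 1 *g x >> + u)) -> forall u, P u.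
Proof.
move=> P0 PD u; rewrite -[u]freeg_sumE.
elim: (dom u) => [|x s IH]; rewrite ?big_nil // big_cons freegUZ.
exact: PD.
Qed.
End FreeModule.

(* The tensor product over a (not necessarily unital) algebra [D] acting on
   [X] from the right and on [H] from the left: the quotient of the free
   module on [X * H] by the span of the bilinearity and balancing relations. *)
Section TensorProduct.
Variables (R : realDomainType).
Local Notation C := (cplx R).
Variables (X H : lmodType C) (D : Type) (xr : X -> D -> X) (hl : D -> H -> H).
Local Notation F := {freeg (X * H)%type / C}.

Definition fpair (x : X) (u : H) : F := << 1 *g (x, u) >>.

Inductive tens_rel : F -> Prop :=
| tens_rel_linl a x y u : tens_rel (fpair (a *: x + y) u - (a *: fpair x u + fpair y u))
| tens_rel_linr a x u v : tens_rel (fpair x (a *: u + v) - (a *: fpair x u + fpair x v))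
| tens_rel_bal x d u : tens_rel (fpair (xr x d) u - fpair x (hl d u)).

Definition tens_span : {pred F} := fun w =>
  `[< forall P : {pred F}, submod_closed P ->
        (forall v, tens_rel v -> v \in P) -> w \in P >].

Fact tens_span_submod : submod_closed tens_span.
Proof.
split=> [|a u v /asboolP uS /asboolP vS]; apply/asboolP=> P Psub rP.
  by case: Psub.
by case: (Psub) => _; apply; [apply: uS | apply: vS].
Qed.

Lemma tens_span_rel v : tens_rel v -> v \in tens_span.
Proof. by move=> rv; apply/asboolP=> P _; apply. Qed.

Definition tensor := lmod_quot tens_span_submod.
HB.instance Definition _ := GRing.Lmodule.on tensor.

Definition tens (x : X) (u : H) : tensor := qclass tens_span_submod (fpair x u).

Lemma tens_linl u : linear (tens^~ u).
Proof.
move=> a x y; rewrite /tens -linearP.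
by apply/eqP; rewrite qclass_eq tens_span_rel //; constructor.
Qed.
Lemma tens_linr x : linear (tens x).
Proof.
move=> a u v; rewrite /tens -linearP.
by apply/eqP; rewrite qclass_eq tens_span_rel //; constructor.
Qed.
Lemma tens_bal x d u : tens (xr x d) u = tens x (hl d u).
Proof. by apply/eqP; rewrite qclass_eq tens_span_rel //; constructor. Qed.

Lemma tensor_ind (P : tensor -> Prop) :
  P 0 -> (forall k x u t, P t -> P (k *: tens x u + t)) -> forall t, P t.
Proof.
move=> P0 PD t; rewrite -[t]qreprK.
elim/freeg_ind: (qrepr t) => [|k [x u] w Pw]; first by rewrite linear0.
by rewrite linearP; apply: PD.
Qed.

(* The linear map on the tensor product given by a balanced bilinear map. *)
Definition tlift (W : lmodType C) (f : X -> H -> W) (t : tensor) : W :=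
  fglift (fun p : X * H => f p.1 p.2) (qrepr t).

Section Lift.
Variables (W : lmodType C) (f : X -> H -> W).
Hypotheses (f_linl : forall u, linear (f^~ u)) (f_linr : forall x, linear (f x))
           (f_bal : forall x d u, f (xr x d) u = f x (hl d u)).
Local Notation f' := (fun p : X * H => f p.1 p.2).

Let fl := fglift_is_linear f'.

Lemma fglift_pair x u : fglift f' (fpair x u) = f x u.
Proof. by rewrite liftU scale1r. Qed.

Lemma fglift_span w : w \in tens_span -> fglift f' w = 0.
Proof.
move=> /asboolP /(_ (fun w => fglift f' w == 0)) wP; apply/eqP/wP.
  split=> [|a u v /eqP u0 /eqP v0]; apply/eqP; first exact: lin0.
  by rewrite fl u0 v0 scaler0 addr0.
move=> v; case=> [a x y u|a x u v'|x d u]; apply/eqP; rewrite (linB fl) ?fl !fglift_pair.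
- by rewrite (f_linl u) subrr.
- by rewrite (f_linr x) subrr.
- by rewrite f_bal subrr.
Qed.

Lemma tlift_class w : tlift f (qclass tens_span_submod w) = fglift f' w.
Proof.
apply/eqP; rewrite -subr_eq0 -(linB fl); apply/eqP/fglift_span.
exact: qrepr_class.
Qed.

Lemma tlift_linear : linear (tlift f).
Proof.
move=> a s t; rewrite -[s]qreprK -[t]qreprK -linearP !tlift_class.
exact: fl.
Qed.

Lemma tliftE x u : tlift f (tens x u) = f x u.
Proof. by rewrite tlift_class fglift_pair. Qed.

End Lift.
End TensorProduct.

Section Rieffel.
Variables (R : realDomainType) (B D : starAlg R).
Local Notation C := (cplx R).
Variables (X : bimodule B D) (H : starRep D).

Definition rieffel_tensor : lmodType C := tensor (@ract R B D X) (@rep R D H).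
Definition rtens (x : X) (u : H) : rieffel_tensor := tens (@ract R B D X) (@rep R D H) x u.

(* [pair_form y v t] is [< y (x) v, t >]; it is linear in [t]. *)
Definition pair_form (y : X) (v : H) (t : rieffel_tensor) : C :=
  tlift (W := C^o) (fun x u => ip v (rep (inner y x) u)) t.

(* The sesquilinear form with
   [< x (x) u, y (x) v > = < u, pi(<x, y>_D) v >], see [rformE]. *)
Definition rform (s t : rieffel_tensor) : C :=
  tlift (W := C^o) (fun y v => cconj (pair_form y v s)) t.

Lemma rep_herm (a : D) (u v : H) : ip v (rep (star a) u) = cconj (ip u (rep a v)).
Proof. by rewrite (rep_adj a u v) -ip_herm. Qed.

Lemma pair_bil_linr (y : X) (v : H) (x : X) : linear (fun u : H => ip v (rep (inner y x) u) : C^o).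
Proof. by move=> a u u'; rewrite rep_linr ip_lin. Qed.
Lemma pair_bil_linl (y : X) (v u : H) : linear (fun x : X => ip v (rep (inner y x) u) : C^o).
Proof. by move=> a x x'; rewrite inner_lin rep_linl ip_lin. Qed.
Lemma pair_bil_bal (y : X) (v : H) x d u :
  ip v (rep (inner y (ract x d)) u) = ip v (rep (inner y x) (rep d u)).
Proof. by rewrite inner_ract repM. Qed.

Lemma pair_formE y v x u : pair_form y v (rtens x u) = ip v (rep (inner y x) u).
Proof.
exact: (tliftE (W := C^o) (pair_bil_linl y v) (pair_bil_linr y v) (@pair_bil_bal y v)).
Qed.
Lemma pair_form_lin y v : linear (pair_form y v : _ -> C^o).
Proof.
exact: (tlift_linear (W := C^o) (pair_bil_linl y v) (pair_bil_linr y v) (@pair_bil_bal y v)).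
Qed.

Lemma pair_form_linl v s : linear (fun y => cconj (pair_form y v s) : C^o).
Proof.
move=> a y y'; elim/tensor_ind: s => [|k x u s IH].
  by rewrite !(lin0 (@pair_form_lin _ _)) !rmorph0 scaler0 addr0.
move: IH; rewrite -![tens _ _ _ _]/(rtens _ _) !(pair_form_lin _ _ k).
rewrite !rmorphD /= => ->; rewrite !pair_formE.
rewrite [inner (a *: y + y') x]inner_herm inner_lin star_antilin rep_linl ip_lin.
rewrite -!inner_herm !rmorphM !rmorphD !rmorphM /= cconjK /GRing.scale /=; ring.
Qed.
Lemma pair_form_linr y s : linear (fun v => cconj (pair_form y v s) : C^o).
Proof.
move=> a v v'; elim/tensor_ind: s => [|k x u s IH].
  by rewrite !(lin0 (@pair_form_lin _ _)) !rmorph0 scaler0 addr0.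
move: IH; rewrite -![tens _ _ _ _]/(rtens _ _) !(pair_form_lin _ _ k).
rewrite !rmorphD /= => ->; rewrite !pair_formE !rmorphM /= -!ip_herm.
rewrite (ip_lin _ a) /GRing.scale /=; ring.
Qed.
Lemma pair_form_bal y d v s :
  cconj (pair_form (ract y d) v s) = cconj (pair_form y (rep d v) s).
Proof.
congr cconj; elim/tensor_ind: s => [|k x u s IH].
  by rewrite !(lin0 (@pair_form_lin _ _)).
rewrite -![tens _ _ _ _]/(rtens _ _) !(pair_form_lin _ _ k) IH.
rewrite !pair_formE [inner (ract y d) x]inner_herm inner_ract starM repM -inner_herm.
by rewrite (rep_adj (star d)) starK.
Qed.

Lemma rform_lin s : scalar (rform s).
Proof.
exact: (tlift_linear (W := C^o) (fun v => pair_form_linl v s) (fun y => pair_form_linr y s)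
  (fun y d v => pair_form_bal y d v s)).
Qed.

Lemma rform_tensr s y v : rform s (rtens y v) = cconj (pair_form y v s).
Proof.
exact: (tliftE (W := C^o) (fun v => pair_form_linl v s) (fun y => pair_form_linr y s)
  (fun y d v => pair_form_bal y d v s)).
Qed.

Lemma rformE x u y v : rform (rtens x u) (rtens y v) = ip u (rep (inner x y) v).
Proof. by rewrite rform_tensr pair_formE inner_herm rep_herm cconjK. Qed.

Lemma rform_tensl y v t : rform (rtens y v) t = pair_form y v t.
Proof.
elim/tensor_ind: t => [|k x u t IH].
  by rewrite (sform0r rform_lin) (lin0 (@pair_form_lin _ _)).
by rewrite -![tens _ _ _ _]/(rtens _ _) rform_lin pair_form_lin IH rformE pair_formE.
Qed.

Lemma rform_herm s t : rform t s = cconj (rform s t).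
Proof.
elim/tensor_ind: t => [|k y v t IH].
  rewrite (sform0r rform_lin) rmorph0.
  elim/tensor_ind: s => [|k x u s IH]; first exact: (sform0r rform_lin).
  rewrite -![tens _ _ _ _]/(rtens _ _) rform_lin IH rform_tensr.
  by rewrite (lin0 (@pair_form_lin _ _)) rmorph0 mulr0 addr0.
rewrite -![tens _ _ _ _]/(rtens _ _) rform_lin rmorphD rmorphM /= -IH rform_tensr cconjK.
elim/tensor_ind: s {IH} => [|l x u s IH].
  by rewrite !(sform0r rform_lin) (lin0 (@pair_form_lin _ _)) mulr0 addr0.
rewrite -![tens _ _ _ _]/(rtens _ _) !rform_lin IH (pair_form_lin _ _ l).
rewrite !rform_tensr pair_formE (pair_form_lin _ _ k) pair_formE.
rewrite rmorphD rmorphM /= -rep_herm -inner_herm /GRing.scale /=; ring.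
Qed.

Definition rieffel_psd : Prop := forall t, cge0 (rform t t).

Definition ract_tensor (b : B) (t : rieffel_tensor) : rieffel_tensor :=
  tlift (fun x u => rtens (lact b x) u) t.

Definition rieffel_orth : {pred rieffel_tensor} := fun t => `[< forall s, rform s t = 0 >].

Fact rieffel_orth_submod : submod_closed rieffel_orth.
Proof.
split=> [|a t u /asboolP t0 /asboolP u0]; apply/asboolP=> s.
  exact: (sform0r rform_lin).
by rewrite rform_lin t0 u0 mulr0 addr0.
Qed.

Lemma lact_bil_linl b u : linear (fun x => rtens (lact b x) u).
Proof. by move=> a x y; rewrite lact_linr [LHS]tens_linl. Qed.
Lemma lact_bil_linr b x : linear (fun u => rtens (lact b x) u).
Proof. by move=> a u v; rewrite [LHS]tens_linr. Qed.
Lemma lact_bil_bal b x d u : rtens (lact b (ract x d)) u = rtens (lact b x) (rep d u).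
Proof. by rewrite lractA [LHS]tens_bal. Qed.

Lemma ract_tensorE b x u : ract_tensor b (rtens x u) = rtens (lact b x) u.
Proof.
exact: (tliftE (lact_bil_linl b) (lact_bil_linr b) (@lact_bil_bal b)).
Qed.
Lemma ract_tensor_linr b : linear (ract_tensor b).
Proof.
exact: (tlift_linear (lact_bil_linl b) (lact_bil_linr b) (@lact_bil_bal b)).
Qed.
Lemma ract_tensor_linl t : linear (ract_tensor^~ t).
Proof.
move=> a b c; elim/tensor_ind: t => [|k x u t IH].
  by rewrite !(lin0 (ract_tensor_linr _)) scaler0 addr0.
rewrite -![tens _ _ _ _]/(rtens _ _) !(ract_tensor_linr _ k) IH !ract_tensorE.
rewrite lact_linl [rtens _ u]tens_linl -![tens _ _ _ _]/(rtens _ _).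
by rewrite !scalerDr !scalerA [k * a]mulrC addrACA.
Qed.
Lemma ract_tensorM b c t : ract_tensor (smul b c) t = ract_tensor b (ract_tensor c t).
Proof.
elim/tensor_ind: t => [|k x u t IH].
  by rewrite !(lin0 (ract_tensor_linr _)).
by rewrite -![tens _ _ _ _]/(rtens _ _) !(ract_tensor_linr _ k) IH !ract_tensorE lactM.
Qed.
Lemma ract_tensor_adj b s t : rform s (ract_tensor b t) = rform (ract_tensor (star b) s) t.
Proof.
elim/tensor_ind: t => [|k y v t IH].
  by rewrite (lin0 (ract_tensor_linr _)) !(sform0r rform_lin).
rewrite -![tens _ _ _ _]/(rtens _ _) ract_tensor_linr !rform_lin IH ract_tensorE.
congr (_ * _ + _).
elim/tensor_ind: s {IH} => [|l x u s IH].
  by rewrite (lin0 (ract_tensor_linr _)) !rform_tensr !(lin0 (@pair_form_lin _ _)).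
rewrite -![tens _ _ _ _]/(rtens _ _) ract_tensor_linr ract_tensorE.
move: IH; rewrite !rform_tensr !(pair_form_lin _ _ l) !rmorphD /= => ->.
by rewrite !pair_formE inner_lact starK.
Qed.

Hypothesis psd : rieffel_psd.

Fact rieffel_orthP t : (t \in rieffel_orth) <-> (rform t t = 0).
Proof.
split=> [/asboolP ->|t0] //.
by apply/asboolP; apply: (form_degenerate rform_lin rform_herm psd t0).
Qed.

Definition rieffel_induced : starRep B :=
  quot_starRep rform_lin rform_herm psd rieffel_orth_submod rieffel_orthP
    ract_tensor_linr ract_tensor_linl ract_tensorM ract_tensor_adj.

Definition rclass (t : rieffel_tensor) : rieffel_induced := qclass rieffel_orth_submod t.

Lemma rieffel_ipE s t : ip (rclass s) (rclass t) = rform s t.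
Proof. exact: (qformE rform_lin rform_herm psd rieffel_orth_submod rieffel_orthP). Qed.
Lemma rieffel_repE b t : rep b (rclass t) = rclass (ract_tensor b t).
Proof.
exact: (qactE rform_lin rform_herm psd rieffel_orth_submod rieffel_orthP
  ract_tensor_linr ract_tensor_adj).
Qed.

End Rieffel.

Section CanonicalRepresentation.
Variable R : realDomainType.
Local Notation C := (cplx R).

Fact cplx_smul_linr (a : C^o) : linear ( *%R a : C^o -> C^o).
Proof. by move=> z x y; rewrite mulrDr -scalerAr. Qed.
Fact cplx_smul_linl (b : C^o) : linear (fun a : C^o => a * b : C^o).
Proof. by move=> z x y; rewrite mulrDl -scalerAl. Qed.
Fact cplx_star_antilin (z : C) (a b : C^o) :
  cconj (z *: a + b) = cconj z *: (cconj a : C^o) + cconj b :> C^o.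
Proof. by rewrite rmorphD rmorphM. Qed.
Fact cplx_starM (a b : C^o) : cconj (a * b) = cconj b * cconj a :> C^o.
Proof. by rewrite mulrC rmorphM. Qed.

Definition cplx_starAlg : starAlg R :=
  @StarAlg R C^o *%R (@cconj R) (@mulrA C) cplx_smul_linr cplx_smul_linl
    cplx_star_antilin (@cconjK R) cplx_starM.

Definition cplx_ip (z w : C^o) : C := cconj z * w.

Fact cplx_ip_lin z : scalar (cplx_ip z).
Proof. by move=> a x y; rewrite /cplx_ip mulrDr mulrCA. Qed.
Fact cplx_ip_herm z w : cplx_ip w z = cconj (cplx_ip z w).
Proof. by rewrite /cplx_ip rmorphM /= cconjK mulrC. Qed.
Fact cplx_ip_ge0 z : cge0 (cplx_ip z z). Proof. exact: cge0_conjM. Qed.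
Fact cplx_ip_eq0 z : cplx_ip z z = 0 -> z = 0.
Proof.
move=> /(congr1 (@complex.Re R)); rewrite ReM ReJ ImJ mulNr opprK => /eqP.
rewrite paddr_eq0 -?expr2 ?sqr_ge0 // !expf_eq0 /= => /andP[/eqP ? /eqP ?].
exact: cplxP.
Qed.

Definition cplx_preHilbert : preHilbert R :=
  PreHilbert cplx_ip_lin cplx_ip_herm cplx_ip_ge0 cplx_ip_eq0.

Fact cplx_repM (a b x : C^o) : a * b * x = a * (b * x) :> C^o.
Proof. by rewrite mulrA. Qed.
Fact cplx_rep_adj (a : C^o) :
  is_adjoint (H := cplx_preHilbert) ( *%R a) ( *%R (cconj a)).
Proof. by move=> x y; rewrite /= /cplx_ip rmorphM /= cconjK mulrCA mulrA. Qed.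

Definition canonical_rep : starRep cplx_starAlg :=
  @StarRep R cplx_starAlg cplx_preHilbert *%R cplx_smul_linr cplx_smul_linl
    cplx_repM cplx_rep_adj.

Lemma cplx_sa_ge0 (z : cplx_starAlg) : cge0 z -> sa_ge0 z.
Proof.
move=> z0 f f_pos.
have fE : f z = z * f 1 by rewrite -[in LHS](mulr1 z) -[z * 1]/(z *: (1 : C^o)) linearZ.
rewrite fE; apply: cge0M => //.
by have := f_pos (1 : C^o); rewrite -[smul _ _]/(cconj 1 * 1 : C) rmorph1 mulr1.
Qed.

End CanonicalRepresentation.

Section GNS.
Variables (R : realDomainType) (A : starAlg R) (omega : {scalar A}).
Local Notation C := (cplx R).

Definition gns_form (a b : A) : C := omega (smul (star a) b).

Definition gns_ideal : {pred A} := fun a => omega (smul (star a) a) == 0.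

Lemma gns_form_lin a : scalar (gns_form a).
Proof. by move=> z b c; rewrite /gns_form smul_linr linearP. Qed.

Lemma gns_formDl a b c : gns_form (a + b) c = gns_form a c + gns_form b c.
Proof.
rewrite /gns_form star_additive.
by rewrite (linD (smul_linl c)) linearD.
Qed.
Lemma gns_formZl z a b : gns_form (z *: a) b = cconj z * gns_form a b.
Proof. by rewrite /gns_form starZ (linZ (smul_linl b)) linearZ. Qed.

Hypothesis omega_pos : positive_functional omega.

Lemma gns_form_herm a b : gns_form b a = cconj (gns_form a b).
Proof.
pose i : cplx R := Complex 0 1.
have [I0 _] := omega_pos a; have [I1 _] := omega_pos b.
have [I2 _] := omega_pos (a + b); have [I3 _] := omega_pos (a + i *: b).
move: I0 I1 I2 I3; rewrite -!/(gns_form _ _).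
rewrite !gns_formDl !gns_formZl !(sformDr gns_form_lin) !(sformZr gns_form_lin).
set p := gns_form a b; set q := gns_form b a.
rewrite !ImD => -> Ib; rewrite !(ImM, ReM, ReJ, ImJ, ReD, ImD) /= Ib => E1 E2.
by apply: cplxP; rewrite ?ReJ ?ImJ; lra.
Qed.

Fact gns_form_ge0 a : cge0 (gns_form a a). Proof. exact: omega_pos. Qed.

Fact gns_idealP a : (a \in gns_ideal) <-> (gns_form a a = 0).
Proof. by split=> /eqP. Qed.

Lemma gns_null a : a \in gns_ideal -> forall b, gns_form b a = 0.
Proof.
by move=> /gns_idealP a0; apply: (form_degenerate gns_form_lin gns_form_herm gns_form_ge0 a0).
Qed.

Fact gns_ideal_submod : submod_closed gns_ideal.
Proof.
split=> [|z a b aJ bJ]; apply/gns_idealP; first exact: (sform0r gns_form_lin).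
by rewrite gns_form_lin !gns_null // mulr0 addr0.
Qed.

Fact gns_act_adj a b c : gns_form b (smul a c) = gns_form (smul (star a) b) c.
Proof. by rewrite /gns_form starM starK smulA. Qed.

Lemma gns_left_ideal a b : b \in gns_ideal -> smul a b \in gns_ideal.
Proof. by move=> bJ; apply/gns_idealP; rewrite -[LHS]/(gns_form _ _) gns_act_adj; exact: gns_null. Qed.

Fact gns_actM (a b c : A) : smul (smul a b) c = smul a (smul b c).
Proof. by rewrite smulA. Qed.

Definition gns_rep : starRep A :=
  quot_starRep gns_form_lin gns_form_herm gns_form_ge0 gns_ideal_submod gns_idealP
    (@smul_linr R A) (@smul_linl R A) gns_actM gns_act_adj.

Definition gns_class (a : A) : gns_rep := qclass gns_ideal_submod a.

Lemma gns_ipE a b : ip (gns_class a) (gns_class b) = omega (smul (star a) b).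
Proof. exact: (qformE gns_form_lin gns_form_herm gns_form_ge0 gns_ideal_submod gns_idealP). Qed.
Lemma gns_repE a b : rep a (gns_class b) = gns_class (smul a b).
Proof. exact: (qactE gns_form_lin gns_form_herm gns_form_ge0 gns_ideal_submod gns_idealP (@smul_linr R A) gns_act_adj). Qed.

(* [A] as an [(A-C)]-bimodule, with inner product [omega (a^* b)]. *)
Fact gns_ract_linr (a : A) : linear (fun z : C^o => z *: a).
Proof. by move=> k z w; rewrite scalerDl scalerA. Qed.
Fact gns_ract_linl (z : C^o) : linear (fun a : A => z *: a).
Proof. by move=> k a b; rewrite scalerDr !scalerA mulrC. Qed.
Fact gns_ractM (a : A) (z w : C^o) : (z * w) *: a = w *: (z *: a).
Proof. by rewrite scalerA mulrC. Qed.
Fact gns_lractA (a b : A) (z : C^o) : smul a (z *: b) = z *: smul a b.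
Proof. exact: (linZ (smul_linr a)). Qed.
Fact gns_inner_ract (a b : A) (z : C^o) : gns_form a (z *: b) = gns_form a b * z.
Proof. by rewrite (sformZr gns_form_lin) mulrC. Qed.
Fact gns_inner_ge0 (a : A) : @sa_ge0 R (cplx_starAlg R) (gns_form a a).
Proof. exact/cplx_sa_ge0/gns_form_ge0. Qed.

Definition gns_bimodule : bimodule A (cplx_starAlg R) :=
  @Bimodule R A (cplx_starAlg R) A (@smul R A) (fun a z => z *: a) gns_form
    (@smul_linr R A) (@smul_linl R A) gns_ract_linr gns_ract_linl gns_actM gns_ractM
    gns_lractA gns_form_lin gns_form_herm gns_inner_ract gns_act_adj gns_inner_ge0.

End GNS.

(* Main.v *)
(** Since [C] is unital, every element of [A (x) C] is the elementary tensor
    [kappa t (x) 1], where [kappa (a (x) z) = z a].  Hence [kappa] is bijective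
    and carries the Rieffel form to [(a, b) |-> omega (a^* b)] and the induced
    action to left multiplication, so it descends to a unitary intertwiner of
    the quotients by the null spaces. *)
Require Import Defs.
From mathcomp Require Import all_boot all_order all_algebra.

Set Implicit Arguments.
Unset Strict Implicit.
Unset Printing Implicit Defensive.

Import GRing.Theory Num.Theory.
Local Open Scope ring_scope.

(** If [U x = U y], then [x - y] has zero inner product with itself, and [ip] is definite on [H]. *)
Lemma isometry_inj (R : realDomainType) (H K : preHilbert R) (U : H -> K) :
  linear U -> (forall x y, ip (U x) (U y) = ip x y) -> injective U.
Proof.
move=> Ulin Uip x y Uxy; apply/eqP; rewrite -subr_eq0; apply/eqP/ip_eq0.
by rewrite -Uip (linB Ulin) Uxy subrr (sform0r (@ip_lin R K)).
Qed.

Section GNSRieffel.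
Variables (R : realDomainType) (A : starAlg R) (omega : {scalar A}).
Hypothesis omega_pos : positive_functional omega.
Local Notation X := (gns_bimodule omega_pos).
Local Notation C1 := (canonical_rep R).
Local Notation T := (rieffel_tensor X C1).

Definition tensor_scale (t : T) : A := tlift (fun (a : A) (z : C1) => z *: a) t.

Lemma scale_linl (z : C1) : linear (fun a : X => z *: (a : A)).
Proof. exact: gns_ract_linl. Qed.
Lemma scale_linr (a : X) : linear (fun z : C1 => z *: (a : A)).
Proof. exact: gns_ract_linr. Qed.
Lemma scale_bal (a : X) (d : cplx_starAlg R) (z : C1) :
  z *: (ract a d : A) = (rep d z : C1) *: (a : A).
Proof. by rewrite /= scalerA mulrC. Qed.

Lemma tensor_scale_lin : linear tensor_scale.
Proof. exact: (tlift_linear scale_linl scale_linr scale_bal). Qed.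

Lemma tensor_scaleE (a : X) (z : C1) : tensor_scale (rtens a z) = z *: (a : A).
Proof. exact: (tliftE scale_linl scale_linr scale_bal). Qed.

Definition unit_vec : C1 := (1 : cplx R).

(** The candidate inverse of [tensor_scale]. *)
Definition tensor1 (a : X) : T := rtens a unit_vec.

Lemma tensor1_lin : linear tensor1.
Proof. exact: tens_linl. Qed.

Lemma tensor1K : cancel tensor1 tensor_scale.
Proof. by move=> a; rewrite tensor_scaleE scale1r. Qed.

Lemma tensor_scaleK : cancel tensor_scale tensor1.
Proof.
elim/tensor_ind => [|k a z t IH].
  by rewrite (lin0 tensor_scale_lin) (lin0 tensor1_lin).
rewrite tensor_scale_lin tensor1_lin IH -[tens _ _ _ _]/(rtens _ _) tensor_scaleE.
congr (_ *: _ + _).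
(* The right action of [z] on [a] is [z *: a], so the balancing relation moves [z] onto the unit
   vector. *)
transitivity (rtens a (rep (z : cplx_starAlg R) unit_vec)).
  exact: (tens_bal (@ract R _ _ X) (@rep R _ C1)).
by congr rtens; apply: mulr1.
Qed.

(** Both arguments are rewritten as values of [tensor1], so the form is needed only on elementary
    tensors with second factor 1. *)
Lemma rform_gns (s t : T) :
  rform s t = gns_form omega (tensor_scale s) (tensor_scale t).
Proof.
rewrite -{1}[s]tensor_scaleK -{1}[t]tensor_scaleK rformE /= /cplx_ip.
by rewrite rmorph1 mul1r mulr1.
Qed.

(** Positivity of [omega] covers every tensor, sums included, and so makes the induced
    representation available. *)
Lemma gns_rieffel_psd : rieffel_psd X C1.
Proof. by move=> t; rewrite rform_gns; apply: omega_pos. Qed.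

Lemma tensor_scale_act (a : A) (t : T) :
  tensor_scale (ract_tensor a t) = smul a (tensor_scale t).
Proof. by rewrite -{1}[t]tensor_scaleK ract_tensorE tensor1K. Qed.

Local Notation psd := gns_rieffel_psd.

(** Uses a chosen representative; [rieffel_gnsE] shows independence of the choice. *)
Definition rieffel_gns (q : rieffel_induced psd) : gns_rep omega_pos :=
  gns_class omega_pos (tensor_scale (qrepr q)).

(** Two representatives differ by a null vector of [rform], which [tensor_scale] sends into
    [gns_ideal] by [rform_gns]. *)
Lemma rieffel_gnsE t : rieffel_gns (rclass psd t) = gns_class omega_pos (tensor_scale t).
Proof.
apply/eqP; rewrite qclass_eq -(linB tensor_scale_lin); apply/eqP.
rewrite -[LHS]/(gns_form _ _ _) -rform_gns; apply/(rieffel_orthP psd).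
exact: qrepr_class.
Qed.

Lemma rclass_repr (q : rieffel_induced psd) : rclass psd (qrepr q) = q.
Proof. exact: qreprK. Qed.

Lemma rclass_lin : linear (rclass psd).
Proof. exact: (linearP (qclass (rieffel_orth_submod X C1))). Qed.

Lemma rieffel_gns_lin : linear rieffel_gns.
Proof.
move=> k p q; rewrite -[p]rclass_repr -[q]rclass_repr.
rewrite -rclass_lin !rieffel_gnsE tensor_scale_lin.
exact: (linearP (qclass (gns_ideal_submod omega_pos))).
Qed.

Lemma rieffel_gns_ip p q : ip (rieffel_gns p) (rieffel_gns q) = ip p q.
Proof.
rewrite -[p]rclass_repr -[q]rclass_repr !rieffel_gnsE gns_ipE.
by rewrite -[LHS]/(gns_form _ _ _) -rform_gns rieffel_ipE.
Qed.

Lemma rieffel_gns_intertwiner : intertwiner rieffel_gns.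
Proof.
move=> a q; rewrite -[q]rclass_repr rieffel_repE !rieffel_gnsE gns_repE.
by rewrite tensor_scale_act.
Qed.

Lemma rieffel_gns_unitary : unitary rieffel_gns.
Proof.
have inj := isometry_inj rieffel_gns_lin rieffel_gns_ip.
split; [exact: rieffel_gns_lin | | exact: rieffel_gns_ip].
(* Only a right inverse is checked directly; injectivity makes it two-sided, so its own independence
   of representatives is never verified. *)
have VK : cancel (fun p : gns_rep omega_pos => rclass psd (tensor1 (qrepr p))) rieffel_gns.
  by move=> p; rewrite rieffel_gnsE tensor1K; apply: qreprK.
by exists (fun p => rclass psd (tensor1 (qrepr p))) => // q; apply: inj; rewrite VK.
Qed.

End GNSRieffel.

Theorem proposition4p7 (R : realDomainType) (A : starAlg R)
    (omega : {scalar A}) (omega_pos : positive_functional omega) :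
  exists2 kappa : rieffel_tensor (gns_bimodule omega_pos) (canonical_rep R) -> A,
    [/\ linear kappa, bijective kappa &
        forall (a : gns_bimodule omega_pos) (z : canonical_rep R),
          kappa (rtens a z) = z *: a] &
    exists psd : rieffel_psd (gns_bimodule omega_pos) (canonical_rep R),
    exists U : rieffel_induced psd -> gns_rep omega_pos,
      [/\ unitary U, intertwiner U,
          forall t, U (rclass psd t) = gns_class omega_pos (kappa t) &
          forall (a : gns_bimodule omega_pos) (z : canonical_rep R),
            U (rclass psd (rtens a z)) = gns_class omega_pos (z *: (a : A))].
Proof.
exists (@tensor_scale R A omega omega_pos).
  split; [exact: tensor_scale_lin | | exact: tensor_scaleE].
  by exists (@tensor1 R A omega omega_pos); [exact: tensor_scaleK | exact: tensor1K].
exists (@gns_rieffel_psd R A omega omega_pos), (@rieffel_gns R A omega omega_pos); split.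
- exact: rieffel_gns_unitary.
- exact: rieffel_gns_intertwiner.
- exact: rieffel_gnsE.
- by move=> a z; rewrite rieffel_gnsE tensor_scaleE.
Qed.
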